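(* Let $\cong$ be a congruence on LTSs such that $L\doteq L'$ implies $L\cong L'$, $\cong$ preserves $\mathit{Tr}$ but does not preserve $\mathit{Inf}$, and $D\cong V$. Then $\cong$ is the equivalence induced by $\Sigma$ and $\mathit{Tr}$.
   Context: An LTS is a tuple $L=(S,\Sigma,\Delta,\hat s)$ with states $S$, alphabet $\Sigma$ (possibly infinite), $\tau\notin\Sigma$ a reserved invisible action, transitions $\Delta\subseteq S\times(\Sigma\cup\{\tau\})\times S$, initial state $\hat s$; $\Sigma(L)$ denotes the alphabet. Operators: action prefix $a.L$ ($a\neq\tau$): new initial state $\hat s'$, alphabet $\Sigma\cup\{a\}$, transitions $\Delta\cup\{(\hat s',a,\hat s)\}$. Hiding $L\setminus A$: alphabet $\Sigma\setminus A$, each transition labelled by an element of $A$ relabelled $\tau$, otherwise unchanged. Relational renaming $L\Phi$ ($\Phi$ a set of pairs, $\tau$ not in its domain $\mathcal D(\Phi)$ or range; $\Phi(a,b)$ means $(a,b)\in\Phi$ or $a=b\notin\mathcal D(\Phi)$): alphabet $\{b\mid\exists a\in\Sigma:\Phi(a,b)\}$, transitions $\{(s,b,s')\mid\exists a:(s,a,s')\in\Delta\wedge\Phi(a,b)\}$, same states and initial state. Parallel composition $L_1\|L_2$: states $S_1\times S_2$, alphabet $\Sigma_1\cup\Sigma_2$, initial $(\hat s_1,\hat s_2)$; actions in $\Sigma_1\cap\Sigma_2$ are taken jointly by both components, all other actions (including $\tau$) by one component while the other stays put. A congruence is an equivalence $\cong$ with $L\cong L'\Rightarrow a.L\cong a.L',\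 L\setminus A\cong L'\setminus A,\ L\Phi\cong L'\Phi,\ L\|L''\cong L'\|L'',\ L''\|L\cong L''\|L'$. For $\sigma=a_1\cdots a_n\in\Sigma^*$, $s\stackrel{\sigma}{\Rightarrow}s'$ means a finite path from $s$ to $s'$ whose non-$\tau$ labels are exactly $a_1,\dots,a_n$ in order; $\hat s\stackrel{\xi}{\Rightarrow}$ for $\xi\in\Sigma^\omega$ means an infinite path from $\hat s$ whose non-$\tau$ label sequence is $\xi$; $s\stackrel{\tau^\omega}{\to}$ means an infinite path of $\tau$-transitions from $s$. Define $\mathit{Tr}(L)=\{\sigma\in\Sigma^*\mid\exists s:\hat s\stackrel\sigma\Rightarrow s\}$, $\mathit{Div}(L)=\{\sigma\in\Sigma^*\mid\exists s:\hat s\stackrel\sigma\Rightarrow s\wedge s\stackrel{\tau^\omega}\to\}$, $\mathit{Inf}(L)=\{\xi\in\Sigma^\omega\mid\hat s\stackrel\xi\Rightarrow\}$, $\mathit{Sf}(L)=\{(\sigma,A)\in\Sigma^*\times2^\Sigma\mid\exists s:\hat s\stackrel\sigma\Rightarrow s\wedge\forall a\in A\cup\{\tau\}\,\forall s':(s,a,s')\notin\Delta\}$. $L\doteq L'$ (CFFD-equivalence) iff $\Sigma,\mathit{Sf},\mathit{Div},\mathit{Inf}$ all agree on $L$ and $L'$. An equivalence preserves $X$ if $L\cong L'\Rightarrow X(L)=X(L')$; the equivalence induced by $\Sigma,X_1,\dots,X_k$ relates $L,L'$ iff all these functions agree on them. $D$ is the one-state LTS with empty alphabet and no transitions; $V$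 is the one-state LTS with empty alphabet and a single $\tau$ self-loop. *)

(* Defs.v *)
From mathcomp Require Import all_boot.
From mathcomp Require Import boolp classical_sets.

Set Implicit Arguments.
Unset Strict Implicit.
Unset Printing Implicit Defensive.

Local Open Scope classical_set_scope.

(* [Act] is the type of all visible actions; an alphabet is an arbitrary subset
   of it. A label is [Some a] for a visible action [a] and [None] for tau, so
   that tau belongs to no alphabet by construction. *)
Record LTS (Act : Type) := MkLTS {
  state : Type;
  alphabet : set Act;
  trans : state -> option Act -> state -> Prop;
  init : state;
  trans_alphabet : forall s a s', trans s (Some a) s' -> alphabet a }.

Arguments init {Act} l.

Definition prefix_trans Act (a : Act) (L : LTS Act)
    (s : option (state L)) (x : option Act) (s' : option (state L)) : Prop :=
  match s, s' with
  | Some t, Some t' => trans t x t'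
  | None, Some t' => x = Some a /\ t' = init L
  | _, None => False
  end.

Lemma prefix_alphabet Act (a : Act) (L : LTS Act) s b s' :
  @prefix_trans Act a L s (Some b) s' -> (alphabet L `|` [set a]) b.
Proof.
case: s s' => [s|] [s'|] //=; first by move=> h; left; exact: trans_alphabet h.
by move=> [[->] _]; right.
Qed.

(* The state [None] is the new initial state. *)
Definition act_prefix Act (a : Act) (L : LTS Act) : LTS Act :=
  @MkLTS Act (option (state L)) (alphabet L `|` [set a])
    (@prefix_trans Act a L) None (@prefix_alphabet Act a L).

Definition hide_trans Act (L : LTS Act) (A : set Act)
    (s : state L) (x : option Act) (s' : state L) : Prop :=
  match x with
  | Some a => trans s (Some a) s' /\ ~ A a
  | None => trans s None s' \/ exists2 a, A a & trans s (Some a) s'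
  end.

Lemma hide_alphabet Act (L : LTS Act) (A : set Act) s b s' :
  @hide_trans Act L A s (Some b) s' -> (alphabet L `\` A) b.
Proof. by move=> [h nAb]; split=> //; exact: trans_alphabet h. Qed.

Definition hide Act (L : LTS Act) (A : set Act) : LTS Act :=
  @MkLTS Act (state L) (alphabet L `\` A)
    (@hide_trans Act L A) (init L) (@hide_alphabet Act L A).

Definition in_dom Act (Phi : set (Act * Act)) (a : Act) : Prop :=
  exists b, Phi (a, b).

Definition ren Act (Phi : set (Act * Act)) (a b : Act) : Prop :=
  Phi (a, b) \/ (a = b /\ ~ in_dom Phi a).

Definition relabel_trans Act (L : LTS Act) (Phi : set (Act * Act))
    (s : state L) (x : option Act) (s' : state L) : Prop :=
  match x with
  | Some b => exists2 a, trans s (Some a) s' & ren Phi a b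
  | None => trans s None s'
  end.

Lemma relabel_alphabet Act (L : LTS Act) (Phi : set (Act * Act)) s b s' :
  @relabel_trans Act L Phi s (Some b) s' ->
  [set b | exists2 a, alphabet L a & ren Phi a b] b.
Proof. by move=> [a h ab]; exists a => //; exact: trans_alphabet h. Qed.

Definition relabel Act (L : LTS Act) (Phi : set (Act * Act)) : LTS Act :=
  @MkLTS Act (state L) [set b | exists2 a, alphabet L a & ren Phi a b]
    (@relabel_trans Act L Phi) (init L) (@relabel_alphabet Act L Phi).

Definition in_alphabet Act (L : LTS Act) (x : option Act) : Prop :=
  match x with Some a => alphabet L a | None => False end.

Definition par_trans Act (L1 L2 : LTS Act) (s : state L1 * state L2)
    (x : option Act) (s' : state L1 * state L2) : Prop :=
  [\/ [/\ in_alphabet L1 x, in_alphabet L2 x, trans s.1 x s'.1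
        & trans s.2 x s'.2],
      [/\ ~ in_alphabet L2 x, trans s.1 x s'.1 & s'.2 = s.2]
    | [/\ ~ in_alphabet L1 x, trans s.2 x s'.2 & s'.1 = s.1]].

Lemma par_alphabet Act (L1 L2 : LTS Act) s b s' :
  @par_trans Act L1 L2 s (Some b) s' -> (alphabet L1 `|` alphabet L2) b.
Proof.
move=> [[h _ _ _]|[_ h _]|[_ h _]]; first by left.
- by left; exact: trans_alphabet h.
- by right; exact: trans_alphabet h.
Qed.

Definition par Act (L1 L2 : LTS Act) : LTS Act :=
  @MkLTS Act (state L1 * state L2)%type (alphabet L1 `|` alphabet L2)
    (@par_trans Act L1 L2) (init L1, init L2) (@par_alphabet Act L1 L2).

Record congruence Act (cong : LTS Act -> LTS Act -> Prop) : Prop := {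
  cong_refl : forall L, cong L L;
  cong_sym : forall L L', cong L L' -> cong L' L;
  cong_trans : forall L L' L'', cong L L' -> cong L' L'' -> cong L L'';
  cong_prefix : forall a L L',
    cong L L' -> cong (act_prefix a L) (act_prefix a L');
  cong_hide : forall A L L', cong L L' -> cong (hide L A) (hide L' A);
  cong_relabel : forall Phi L L',
    cong L L' -> cong (relabel L Phi) (relabel L' Phi);
  cong_parl : forall L'' L L', cong L L' -> cong (par L L'') (par L' L'');
  cong_parr : forall L'' L L', cong L L' -> cong (par L'' L) (par L'' L') }.

Inductive weak Act (L : LTS Act) : state L -> seq Act -> state L -> Prop :=
| weak_nil s : weak s [::] s
| weak_tau s t u sigma : trans s None t -> weak t sigma u -> weak s sigma u
| weak_vis s t u a sigma :
    trans s (Some a) t -> weak t sigma u -> weak s (a :: sigma) u.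

Definition diverges Act (L : LTS Act) (s : state L) : Prop :=
  exists2 p : nat -> state L, p 0 = s & forall i, trans (p i) None (p i.+1).

(* The visible labels of the path [p] with labels [x] occur exactly at the
   positions k 0 < k 1 < k 2 < ..., the one at position [k n] being [xi n]. *)
Definition weak_inf Act (L : LTS Act) (s : state L) (xi : nat -> Act) : Prop :=
  exists (p : nat -> state L) (x : nat -> option Act) (k : nat -> nat),
    [/\ p 0 = s,
        forall i, trans (p i) (x i) (p i.+1),
        forall m n, m < n -> k m < k n,
        forall n, x (k n) = Some (xi n)
      & forall i, (forall n, i <> k n) -> x i = None].

(* The words below range over all of [Act], but [trans_alphabet] forces every
   letter of a word executed by [L] to lie in [alphabet L]. *)
Definition Tr Act (L : LTS Act) : set (seq Act) :=
  [set sigma | exists s, weak (init L) sigma s].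

Definition Div Act (L : LTS Act) : set (seq Act) :=
  [set sigma | exists2 s, weak (init L) sigma s & diverges s].

Definition Inf Act (L : LTS Act) : set (nat -> Act) :=
  [set xi | weak_inf (init L) xi].

Definition Sf Act (L : LTS Act) : set (seq Act * set Act) :=
  [set f | f.2 `<=` alphabet L /\
     exists s, [/\ weak (init L) f.1 s,
                   forall a, f.2 a -> forall s', ~ trans s (Some a) s'
                 & forall s', ~ trans s None s']].

Definition CFFD Act (L L' : LTS Act) : Prop :=
  [/\ alphabet L = alphabet L', Sf L = Sf L', Div L = Div L'
    & Inf L = Inf L'].

Definition preserves Act T (cong : LTS Act -> LTS Act -> Prop)
    (X : LTS Act -> T) : Prop :=
  forall L L', cong L L' -> X L = X L'.

Definition D (Act : Type) : LTS Act :=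
  @MkLTS Act unit set0 (fun _ _ _ => False) tt (fun _ _ _ => id).

Lemma V_alphabet Act (s : unit) (a : Act) (s' : unit) :
  Some a = None -> (set0 : set Act) a.
Proof. by []. Qed.

Definition V (Act : Type) : LTS Act :=
  @MkLTS Act unit set0 (fun _ x _ => x = None) tt (@V_alphabet Act).

(* Main.v *)
Require Import Defs.
From mathcomp Require Import all_boot.
From mathcomp Require Import boolp classical_sets.
From Stdlib Require List.

(** Since [D] and [V] are congruent, so are [L] and [L || V]; in the latter
    every state diverges, so the congruence can only depend on the alphabet,
    the traces and the infinite traces.  Now let [L1], [L2] be congruent and
    [xi] an infinite trace of [L1] only.  Running both in parallel with the
    single path spelling [xi], and then renaming every letter to all letters of
    an alphabet [A], produces congruent [K1], [K2] that both have all of [A^*]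
    as traces, while all of [A^omega] are infinite traces of [K1] and none is
    one of [K2].  For [L] with alphabet [A], [L] is congruent to [L || K1], hence
    to [L || K2], which has the traces of [L] and no infinite trace. *)

Set Implicit Arguments.
Unset Strict Implicit.
Unset Printing Implicit Defensive.

Local Open Scope classical_set_scope.

(** * Weak paths and infinite traces *)

Lemma weak_cat Act (L : LTS Act) (s t u : state L) (rho sigma : seq Act) :
  weak s rho t -> weak t sigma u -> weak s (rho ++ sigma) u.
Proof.
elim=> {s rho t} [s|s s' t rho h _ IH|s s' t a rho h _ IH] //= hu.
- exact: weak_tau h (IH hu).
- exact: weak_vis h (IH hu).
Qed.

Lemma weak_cons_inv Act (L : LTS Act) (s u : state L) (a : Act)
    (sigma : seq Act) :
  weak s (a :: sigma) u ->
  exists v w, [/\ weak s [::] v, trans v (Some a) w & weak w sigma u].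
Proof.
move e: (a :: sigma) => rho h; elim: h e => {s rho u}
  [s|s s' u rho h _ IH|s s' u b rho h hw _] //.
- move=> /IH [v [w [h1 h2 h3]]]; exists v, w; split=> //; exact: weak_tau h h1.
- by case=> -> ->; exists s, s'; split=> //; exact: weak_nil.
Qed.

Lemma weak_alphabet Act (L : LTS Act) (s t : state L) (sigma : seq Act) :
  weak s sigma t -> List.Forall (alphabet L) sigma.
Proof.
elim=> {s sigma t} [s|//|s s' t a sigma h _ IH]; first by constructor.
by constructor=> //; exact: trans_alphabet h.
Qed.

Lemma weak_tau_path Act (L : LTS Act) (s t : state L) :
  weak s [::] t ->
  exists (f : nat -> state L) (n : nat),
    [/\ f 0 = s, f n = t & forall j, j < n -> trans (f j) None (f j.+1)].
Proof.
move e: [::] => rho h; elim: h e => {s rho t}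
  [s|s s' u rho h _ IH|s s' u b rho h hw _] //.
- by move=> _; exists (fun=> s), 0.
- move=> /IH [f [n [f0 fn hf]]].
  exists (fun j => if j is i.+1 then f i else s), n.+1; split=> //.
  by case=> [_|j /hf //]; rewrite f0.
Qed.

Lemma tau_path_weak Act (L : LTS Act) (p : nat -> state L) (m n : nat) :
  m <= n -> (forall i, m <= i < n -> trans (p i) None (p i.+1)) ->
  weak (p m) [::] (p n).
Proof.
move=> /subnKC <-; elim: (n - m) => [|d IH] h.
  by rewrite addn0; exact: weak_nil.
rewrite addnS; apply: (@weak_cat _ _ _ (p (m + d)) _ [::]).
  by apply: IH => i /andP[mi id]; apply: h; rewrite mi addnS ltnW.
apply: (@weak_tau _ _ _ (p (m + d).+1)); last exact: weak_nil.
by apply: h; rewrite leq_addr addnS ltnSn.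
Qed.

Lemma weak_inf_concat Act (L : LTS Act) (f : nat -> nat -> state L)
    (t : nat -> nat) (xi : nat -> Act) :
  (forall n j, j < t n -> trans (f n j) None (f n j.+1)) ->
  (forall n, trans (f n (t n)) (Some (xi n)) (f n.+1 0)) ->
  weak_inf (f 0 0) xi.
Proof.
move=> htau hvis.
(* [c i] is the pair (block, offset in the block) of position [i]; block [n]
   starts at position [start n] and ends with its visible step. *)
pose next (c : nat * nat) := if c.2 < t c.1 then (c.1, c.2.+1) else (c.1.+1, 0).
pose c i := iter i next (0, 0).
pose start n := \sum_(j < n) (t j).+1.
(* By [cP] and [cS], [c] is inverse to the encoding of a pair [(n, j)] with [j <= t n] as
   [start n + j]. *)
have cP i : i = start (c i).1 + (c i).2 /\ (c i).2 <= t (c i).1.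
  elim: i => [|i [IH1 IH2]]; first by rewrite /start big_ord0.
  rewrite [c i.+1]/(next (c i)) /next; case: ltnP => h /=.
    by rewrite addnS -IH1.
  split=> //; rewrite addn0 /start big_ord_recr /= -/(start _) addnS.
  by rewrite {1}IH1; congr (_ + _).+1; apply/eqP; rewrite eqn_leq IH2.
have cS n j : j <= t n -> c (start n + j) = (n, j).
  elim: n j => [|n IHn]; elim=> [|j IHj] hj.
  - by rewrite /start big_ord0.
  - by rewrite addnS [LHS]/(next (c _)) IHj ?(ltnW hj) // /next /= hj.
  - rewrite addn0 /start big_ord_recr /= -/(start _) addnS [LHS]/(next (c _)).
    by rewrite IHn // /next /= ltnn.
  - by rewrite addnS [LHS]/(next (c _)) IHj ?(ltnW hj) // /next /= hj.
have startS n : start n.+1 = start n + (t n).+1.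
  by rewrite /start big_ord_recr.
exists (fun i => f (c i).1 (c i).2),
  (fun i => if (c i).2 < t (c i).1 then None else Some (xi (c i).1)),
  (fun n => start n + t n); split=> //.
- move=> i; rewrite [c i.+1]/(next (c i)) /next; case: ltnP => h /=.
    exact: htau.
  have /eqP <- : t (c i).1 == (c i).2 by rewrite eqn_leq h (cP i).2.
  exact: hvis.
- move=> m n; elim: n => // n IH; rewrite ltnS leq_eqVlt.
  have h : start n + t n < start n.+1 + t n.+1.
    by rewrite startS addnS addSn ltnS leq_addr.
  by case/predU1P=> [-> //|/IH /ltn_trans]; apply.
- by move=> n; rewrite cS //= ltnn.
- move=> i hi; case: ltnP => // h; case: (hi (c i).1).
  by rewrite {1}(cP i).1; congr addn; apply/eqP; rewrite eqn_leq h (cP i).2.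
Qed.

(** Turns infinite traces into sequences of finite weak steps, one per letter, so that facts about
    [weak] carry over to [Inf] index by index. *)
Lemma weak_infP Act (L : LTS Act) (s : state L) (xi : nat -> Act) :
  weak_inf s xi <->
  exists2 q : nat -> state L, q 0 = s &
    forall n, weak (q n) [:: xi n] (q n.+1).
Proof.
split=> [[p [x [k [p0 hp hk hx hN]]]]|[q q0 hq]].
  have homk m n : m <= n -> k m <= k n.
    by rewrite leq_eqVlt => /predU1P[-> //|/hk /ltnW].
  (* The path is cut just after each visible step, so that every piece is a run of taus closed by
     one letter. *)
  pose b n := if n is m.+1 then (k m).+1 else 0.
  exists (p \o b) => // n /=.
  apply: (@weak_cat _ _ _ (p (k n)) _ [::]); last first.
    by apply: (@weak_vis _ _ _ (p (k n).+1)) (weak_nil _); rewrite -hx.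
  apply: tau_path_weak; first by case: n => // n; exact: hk.
  (* No [k m] lies in this range: for [m < n] it is below [b n], and for [n <= m] it is at least
     [k n]. *)
  move=> i /andP[bi ik]; rewrite -(hN i) => [|m e]; first exact: hp.
  move: ik bi; rewrite {}e; case: (leqP n m) => [/homk|].
    by rewrite leqNgt => /negbTE ->.
  case: n => // n; rewrite ltnS => /homk mn _ /=.
  by rewrite ltnNge mn.
have /choice [u hu] : forall n, exists u : state L * state L,
    [/\ weak (q n) [::] u.1, trans u.1 (Some (xi n)) u.2
      & weak u.2 [::] (q n.+1)].
  by move=> n; have [v [w h]] := weak_cons_inv (hq n); exists (v, w).
(* Regrouping: the taus that follow a letter are joined to those that precede the next one, giving
   the blocks of [weak_inf_concat]. *)
pose r n := if n is m.+1 then (u m).2 else s.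
have rv n : weak (r n) [::] (u n).1.
  have [h _ _] := hu n; case: n h => [|n] h; first by rewrite /r -q0.
  by have [_ _ h'] := hu n; exact: (weak_cat h' h).
have /choice [g hg] : forall n, exists g : (nat -> state L) * nat,
    [/\ g.1 0 = r n, g.1 g.2 = (u n).1
      & forall j, j < g.2 -> trans (g.1 j) None (g.1 j.+1)].
  by move=> n; have [f [t h]] := weak_tau_path (rv n); exists (f, t).
have [g0 _ _] := hg 0; rewrite -[s]/(r 0) -g0.
apply: (@weak_inf_concat _ _ (fun n => (g n).1) (fun n => (g n).2)) => n.
  by have [_ _] := hg n.
have [_ -> _] := hg n; have [-> _ _] := hg n.+1.
by have [_ ? _] := hu n.
Qed.

Lemma Inf_alphabet Act (L : LTS Act) (xi : nat -> Act) (n : nat) :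
  Inf L xi -> alphabet L (xi n).
Proof.
by move=> /weak_infP[q _ hq]; have h := weak_alphabet (hq n); inversion h.
Qed.

Lemma Inf_Tr Act (L : LTS Act) (xi : nat -> Act) (n : nat) :
  Inf L xi -> Tr L (mkseq xi n).
Proof.
move=> /weak_infP[q q0 hq]; exists (q n); elim: n => [|n IH].
  by rewrite q0; exact: weak_nil.
by rewrite mkseqS -cats1; exact: weak_cat IH (hq n).
Qed.

(** * Parallel composition over a common alphabet *)

Lemma weak_par_nil_fst Act (L M : LTS Act) (p p' : state (par L M)) :
  weak p [::] p' -> weak p.1 [::] p'.1.
Proof.
move e: [::] => rho h; elim: h e => {p rho p'} [p|p p1 p' rho h _ IH|//] e.
  exact: weak_nil.
case: h => [[]//|[_ h _]|[_ _ <-]]; last exact: IH.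
exact: weak_tau h (IH e).
Qed.

Section SameAlphabet.
Variables (Act : Type) (L M : LTS Act).
Hypothesis sameA : alphabet L = alphabet M.

Lemma weak_par p sigma p' :
  @weak _ (par L M) p sigma p' <->
  weak p.1 sigma p'.1 /\ weak p.2 sigma p'.2.
Proof.
split.
  elim=> {p sigma p'} [p|p p1 p' sigma h _ [IH1 IH2]|p p1 p' a sigma h _ [IH1 IH2]].
  - by split; exact: weak_nil.
  - case: h => [[]//|[_ h e]|[_ h e]].
      by split; [exact: weak_tau h IH1|rewrite -e].
    by split; [rewrite -e|exact: weak_tau h IH2].
  - case: h => [[_ _ h1 h2]|[n h1 _]|[n h2 _]].
    + by split; [exact: weak_vis h1 IH1|exact: weak_vis h2 IH2].
    + by case: n; rewrite /= -sameA; exact: trans_alphabet h1.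
    + by case: n; rewrite /= sameA; exact: trans_alphabet h2.
case: p p' => [s t] [s' t'] /= [h].
(* The run of [L] sets the pace: [M] performs its pending taus just before each joint letter, and
   the remaining ones at the end. *)
have taur u v w : weak v [::] w -> @weak _ (par L M) (u, v) [::] (u, w).
  move e: [::] => rho hv; elim: hv e => {v rho w}
    [v|v v' w rho hv _ IH|//] e; first exact: weak_nil.
  by apply: (@weak_tau _ (par L M) _ (u, v')); [apply: Or33; split=> // []|exact: IH].
elim: h t => {s sigma s'} [s t /taur //|s u s' sigma h _ IH t ht
                          |s u s' a sigma h _ IH t].
- by apply: (@weak_tau _ (par L M) _ (u, t)); [apply: Or32; split=> // []|exact: IH].
- move=> ht; have [v [w [h1 h2 h3]]] := weak_cons_inv ht.
  apply: (@weak_cat _ (par L M) _ (s, v) _ [::]); first exact: taur.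
  apply: (@weak_vis _ (par L M) _ (u, w)); last exact: IH.
  by apply: Or31; split=> //; [exact: trans_alphabet h|exact: trans_alphabet h2].
Qed.

Lemma Tr_par : Tr (par L M) = Tr L `&` Tr M.
Proof.
rewrite eqEsubset; split=> sigma.
  by move=> [p hp]; have [h1 h2] := (weak_par _ _ _).1 hp; split; [exists p.1|exists p.2].
by move=> [[s hs] [t ht]]; exists (s, t); exact: (weak_par _ _ _).2.
Qed.

Lemma Inf_par : Inf (par L M) = Inf L `&` Inf M.
Proof.
rewrite eqEsubset; split=> xi.
  move=> /weak_infP[q q0 hq]; split; apply/weak_infP.
    exists (fun n => (q n).1); first by rewrite q0.
    by move=> n; have [] := (weak_par _ _ _).1 (hq n).
  exists (fun n => (q n).2); first by rewrite q0.
  by move=> n; have [] := (weak_par _ _ _).1 (hq n).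
(* Both sequences are indexed by the number of letters read, so they can be paired although their
   taus occur at different times. *)
move=> [/weak_infP[q q0 hq] /weak_infP[r r0 hr]]; apply/weak_infP.
exists (fun n => (q n, r n)); first by rewrite q0 r0.
by move=> n; apply/weak_par; split; [exact: hq|exact: hr].
Qed.

End SameAlphabet.

(** * Composition with [D] and [V] *)

Section EmptyAlphabet.
Variables (Act : Type) (L N : LTS Act).
Hypothesis emptyA : alphabet N = set0.

Lemma weak_par_fst p sigma p' :
  @weak _ (par L N) p sigma p' -> weak p.1 sigma p'.1.
Proof.
elim=> {p sigma p'} [p|p p1 p' sigma h _ IH|p p1 p' a sigma h _ IH].
- exact: weak_nil.
- by case: h => [[]//|[_ h e]|[_ h e]]; [exact: weak_tau h IH|rewrite -e].
- case: h => [[_ _ h _]|[_ h _]|[_ h _]]; [exact: weak_vis h IH..|].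
  by have := trans_alphabet h; rewrite emptyA.
Qed.

Lemma weak_par_pair s sigma s' t :
  weak s sigma s' -> @weak _ (par L N) (s, t) sigma (s', t).
Proof.
elim=> {s sigma s'} [s|s u s' sigma h _ IH|s u s' a sigma h _ IH].
- exact: weak_nil.
- by apply: weak_tau IH; apply: Or32; split=> // [].
- by apply: weak_vis IH; apply: Or32; split=> //=; rewrite emptyA.
Qed.

Lemma alphabet_par_empty : alphabet (par L N) = alphabet L.
Proof. by rewrite /= emptyA setU0. Qed.

Lemma Tr_par_empty : Tr (par L N) = Tr L.
Proof.
rewrite eqEsubset; split=> sigma [s h].
- by exists s.1; exact: weak_par_fst h.
- by exists (s, init N); exact: weak_par_pair.
Qed.

Lemma Inf_par_empty : Inf (par L N) = Inf L.
Proof.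
rewrite eqEsubset; split=> xi /weak_infP[q q0 hq]; apply/weak_infP.
- exists (fun n => (q n).1) => [|n]; first by rewrite q0.
  exact: weak_par_fst (hq n).
- exists (fun n => (q n, init N)) => [|n]; first by rewrite q0.
  exact: weak_par_pair.
Qed.

End EmptyAlphabet.

Lemma trans_parD Act (L : LTS Act) (s s' : state L) (t t' : unit)
    (x : option Act) :
  @trans _ (par L (D Act)) (s, t) x (s', t') <-> trans s x s'.
Proof.
case: t t' => [] []; split=> [[[]//|[]//|[]//]|h]; apply: Or32; split=> //.
by case: x {h} => // a [].
Qed.

(** [D] neither moves nor blocks anything, so it only adds an inert component to each state. *)
Lemma CFFD_parD Act (L : LTS Act) : CFFD L (par L (D Act)).
Proof.
split.
- by rewrite alphabet_par_empty.
- rewrite eqEsubset; split=> -[sigma B] /= [hB [s [hs hB' hN]]].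
  + split; first by rewrite /= setU0.
    exists (s, tt); split; first exact: weak_par_pair.
    * by move=> a aB [s' t'] /trans_parD; exact: hB'.
    * by move=> [s' t'] /trans_parD; exact: hN.
  + split; first by move: hB; rewrite /= setU0.
    case: s hs hB' hN => s t hs hB' hN; exists s; split.
    * exact: weak_par_fst hs.
    * by move=> a aB s' h; apply: (hB' a aB (s', t)); apply/trans_parD.
    * by move=> s' h; apply: (hN (s', t)); apply/trans_parD.
- rewrite eqEsubset; split=> sigma [s hs [p p0 hp]].
  + exists (s, tt); first exact: weak_par_pair.
    by exists (fun i => (p i, tt)) => [|i]; [rewrite p0|apply/trans_parD].
  + exists s.1; first exact: weak_par_fst hs.
    exists (fun i => (p i).1) => [|i]; first by rewrite p0.
    by apply/(@trans_parD _ _ _ _ (p i).2 (p i.+1).2); rewrite -!surjective_pairing.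
- by rewrite Inf_par_empty.
Qed.

(** This loop leaves no stable state, which erases all stable failures, and makes every trace a
    divergence. *)
Lemma trans_parV_loop Act (L : LTS Act) (p : state (par L (V Act))) :
  trans p None p.
Proof. by apply: Or33; split=> // []. Qed.

Lemma Sf_parV Act (L : LTS Act) : Sf (par L (V Act)) = set0.
Proof.
rewrite eqEsubset; split=> // -[sigma B] [_ [s [_ _ hN]]].
exact: hN (trans_parV_loop s).
Qed.

Lemma Div_parV Act (L : LTS Act) : Div (par L (V Act)) = Tr L.
Proof.
rewrite -(@Tr_par_empty _ L (V Act)) // eqEsubset; split=> sigma [s hs].
  by exists s.
by exists s => //; exists (fun=> s) => // i; exact: trans_parV_loop.
Qed.

(** * Renaming, and the LTS that spells one infinite word *)

Lemma weak_relabel Act (L : LTS Act) (Phi : set (Act * Act)) (s s' : state L)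
    (sigma : seq Act) :
  @weak _ (relabel L Phi) s sigma s' <->
  exists2 rho, List.Forall2 (ren Phi) rho sigma & weak s rho s'.
Proof.
split.
  elim=> {s sigma s'} [s|s u s' sigma h _ [rho h1 h2]
                      |s u s' b sigma [a h ab] _ [rho h1 h2]].
  - by exists [::]; [constructor|exact: weak_nil].
  - by exists rho => //; exact: (@weak_tau _ L _ u).
  - by exists (a :: rho); [constructor|exact: weak_vis h h2].
move=> [rho hrho h]; elim: h sigma hrho => {s rho s'}
  [s|s u s' rho h _ IH|s u s' a rho h _ IH] sigma hrho.
- by inversion hrho; exact: weak_nil.
- by apply: (@weak_tau _ (relabel L Phi) _ u) (IH _ hrho).
- inversion hrho as [|? b ? tl ab htl]; subst.
  by apply: (@weak_vis _ (relabel L Phi) _ u) (IH _ htl); exists a.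
Qed.

Lemma Tr_relabel Act (L : LTS Act) (Phi : set (Act * Act)) :
  Tr (relabel L Phi) =
  [set sigma | exists2 rho, List.Forall2 (ren Phi) rho sigma & Tr L rho].
Proof.
rewrite eqEsubset; split=> sigma.
  by move=> [s /weak_relabel[rho h1 h2]]; exists rho => //; exists s.
by move=> [rho h1 [s h2]]; exists s; apply/weak_relabel; exists rho.
Qed.

Lemma Inf_relabel Act (L : LTS Act) (Phi : set (Act * Act)) :
  Inf (relabel L Phi) =
  [set zeta | exists2 xi, (forall n, ren Phi (xi n) (zeta n)) & Inf L xi].
Proof.
rewrite eqEsubset; split=> zeta.
  move=> /weak_infP[q q0 hq].
  (* Renaming keeps the states, so [q] is reused and a preimage letter is chosen for each step
     separately. *)
  have /choice [xi hxi] : forall n, exists a : Act,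
      ren Phi a (zeta n) /\ @weak _ L (q n) [:: a] (q n.+1).
    move=> n; have /weak_relabel[rho h1 h2] := hq n.
    inversion h1 as [|a ? r ? ab hr]; subst; inversion hr; subst.
    by exists a.
  exists xi => [n|]; first by case: (hxi n).
  by apply/weak_infP; exists q => // n; case: (hxi n).
move=> [xi h /weak_infP[q q0 hq]]; apply/weak_infP; exists q => // n.
by apply/weak_relabel; exists [:: xi n] => //; constructor.
Qed.

(** The path stops at a letter outside [A], so that [path_lts] is defined for every [xi]. Leaving
    [A] free lets its alphabet match that of the LTS it runs beside. *)
Definition path_trans Act (A : set Act) (xi : nat -> Act)
    (m : nat) (x : option Act) (n : nat) : Prop :=
  [/\ x = Some (xi m), n = m.+1 & A (xi m)].

Lemma path_alphabet Act (A : set Act) (xi : nat -> Act) m a n :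
  path_trans A xi m (Some a) n -> A a.
Proof. by move=> [[->]]. Qed.

Definition path_lts Act (A : set Act) (xi : nat -> Act) : LTS Act :=
  MkLTS 0 (@path_alphabet Act A xi).

(** The path is deterministic and free of taus: state [n] is the only one reached after [n] letters,
    and it forces the next letter. *)
Lemma Inf_path Act (A : set Act) (xi : nat -> Act) :
  (forall n, A (xi n)) -> Inf (path_lts A xi) = [set xi].
Proof.
move=> hA; rewrite eqEsubset; split=> zeta; last first.
  move=> ->; apply/weak_infP; exists id => // n.
  by apply: (@weak_vis _ (path_lts A xi) n n.+1 n.+1) (weak_nil _).
move=> /weak_infP[q q0 hq].
have nil_eq (m n : state (path_lts A xi)) : weak m [::] n -> m = n.
  by move e: [::] => rho h; elim: h e => // k l ? ? [].
have hS n : zeta n = xi (q n) /\ q n.+1 = (q n).+1.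
  have [v [w [/nil_eq -> [[->] -> _] /nil_eq <-]]] := weak_cons_inv (hq n).
  by [].
have qE n : q n = n.
  by elim: n => [|n IH]; [exact: q0|rewrite (hS n).2 IH].
by apply/funext => n; rewrite (hS n).1 qE.
Qed.

(** * Congruences implied by CFFD-equivalence *)

Section Congruence.
Variables (Act : Type) (cong : LTS Act -> LTS Act -> Prop).
Hypothesis hcong : congruence cong.
Hypothesis hCFFD : forall L L' : LTS Act, CFFD L L' -> cong L L'.

Lemma preserves_alphabet :
  preserves cong (@Tr Act) -> preserves cong (@alphabet Act).
Proof.
move=> hTr.
suff sub L L' : cong L L' -> alphabet L `<=` alphabet L'.
  move=> L L' h; rewrite eqEsubset; split; first exact: sub.
  exact: sub (cong_sym hcong h).
move=> h a La; apply: contrapT => nL'a.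
(* A looping [a] is free to run beside [L'], which ignores [a], but is blocked
   by [L], which has [a] in its alphabet and, like [L'], never performs it. *)
pose R := path_lts [set a] (fun=> a).
have Ra : Tr (par L' R) [:: a].
  exists (init L', 1); apply: weak_vis (weak_nil _).
  by apply: Or33; split.
rewrite -(hTr _ _ (cong_parl hcong R h)) in Ra.
have aL : Tr L [:: a].
  case: Ra => p hp; have [q [r [hq h2 _]]] := weak_cons_inv hp.
  (* Only taus precede the first letter and they never synchronise, so this projection is valid for
     differing alphabets. *)
  have h3 := weak_par_nil_fst hq.
  case: h2 => [[_ _ h2 _]|[nR _ _]|[nL _ _]] //.
    by exists r.1; apply: (weak_cat h3); exact: weak_vis h2 (weak_nil _).
  by case: nR.
move: aL; rewrite (hTr _ _ h) => -[s /weak_alphabet ha].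
by inversion ha.
Qed.

Hypothesis hDV : cong (D Act) (V Act).

Lemma cong_Tr_Inf L L' :
  alphabet L = alphabet L' -> Tr L = Tr L' -> Inf L = Inf L' -> cong L L'.
Proof.
move=> hA hT hI.
(* [M] is CFFD-equivalent to [par M (D Act)], where [D] may be replaced by [V]. *)
have LV M : cong M (par M (V Act)).
  apply: (cong_trans hcong) (cong_parr hcong M hDV).
  exact/hCFFD/CFFD_parD.
apply: (cong_trans hcong) (LV L) _.
apply: (cong_trans hcong) _ (cong_sym hcong (LV L')).
apply: hCFFD; split.
- by rewrite /= hA.
- by rewrite !Sf_parV.
- by rewrite !Div_parV.
- by rewrite !Inf_par_empty.
Qed.

Hypothesis hTr : preserves cong (@Tr Act).

(** Symmetry of [cong] allows the pair to be ordered so that the first LTS owns the infinite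
    trace. *)
Lemma separating_Inf :
  ~ preserves cong (@Inf Act) ->
  exists L1 L2 xi, [/\ cong L1 L2, Inf L1 xi & ~ Inf L2 xi].
Proof.
move=> hInf; apply: contrapT => no; apply: hInf => L L' h.
rewrite eqEsubset; split=> xi hxi; apply: contrapT => nxi; apply: no.
- by exists L, L', xi.
- by exists L', L, xi; split=> //; by apply: (cong_sym hcong).
Qed.

(** Once both sides of the theorem are moved to such an [L0], [cong_Tr_Inf] has no infinite traces
    left to distinguish. *)
Lemma cong_without_Inf L :
  ~ preserves cong (@Inf Act) ->
  exists L0, [/\ cong L L0, alphabet L0 = alphabet L, Tr L0 = Tr L
               & Inf L0 = set0].
Proof.
move=> /separating_Inf[L1 [L2 [xi [h12 xi1 xi2]]]].
set A := alphabet L.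
(* Over an empty alphabet there are no infinite words and [L] itself serves; otherwise [c] supplies
   a target for the renaming. *)
have [[c Ac]|/nonemptyPn A0] := pselect (A !=set0); last first.
  exists L; split=> //; first exact: cong_refl hcong L.
  rewrite eqEsubset; split=> // zeta /Inf_alphabet => /(_ 0).
  by rewrite -/A A0.
set S := alphabet L1.
have S2 : alphabet L2 = S by rewrite -(preserves_alphabet hTr h12).
pose P := path_lts S xi.
have xiS n : S (xi n) by exact: Inf_alphabet.
pose Phi := S `*` A.
pose K M := relabel (par M P) Phi.
have hK : cong (K L1) (K L2).
  exact/(cong_relabel hcong)/(cong_parl hcong).
(* Thanks to [c], every letter of [S] is in the domain of [Phi], so the identity clause of [ren]
   does not apply to it. *)
have renP a b : S a -> ren Phi a b <-> A b.
  move=> Sa; split=> [[[]//|[_ []]]|Ab]; last by left.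
  by exists c.
have KA M : alphabet M = S -> alphabet (K M) = A.
  move=> MS; have PS : alphabet (par M P) = S by rewrite /= MS setUid.
  rewrite eqEsubset; split=> b.
    by move=> [a]; rewrite PS => Sa /renP; apply.
  by move=> Ab; exists (xi 0); [rewrite PS|apply/renP].
have parA M : alphabet M = S -> alphabet (par L (K M)) = A.
  by move=> MS; rewrite -[RHS]setUid -{2}(KA M MS).
have trP n : Tr P (mkseq xi n) by apply: Inf_Tr; rewrite Inf_path.
have KTr M sigma : alphabet M = S -> Tr M = Tr L1 -> List.Forall A sigma ->
    Tr (K M) sigma.
  (* The prefix of [xi] of the same length is renamed to [sigma]. Finite prefixes of [xi] are traces
     of [L2] too, since [L1] and [L2] have equal traces. *)
  move=> MS MT hs; rewrite Tr_relabel; exists (mkseq xi (size sigma)); last first.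
    by rewrite Tr_par //; split; [rewrite MT; exact: Inf_Tr|exact: trP].
  (* The start 0 of the underlying [iota] is generalised for the induction. *)
  rewrite /mkseq; elim: hs 0 => [|b s Ab _ IH] n /=; constructor=> //.
  by apply/renP.
have sameT M : alphabet M = S -> Tr M = Tr L1 -> Tr (par L (K M)) = Tr L.
  move=> MS MT; rewrite Tr_par ?KA // setIidl // => sigma [s hs].
  exact/KTr/(weak_alphabet hs).
have T2 : Tr L2 = Tr L1 by rewrite (hTr h12).
exists (par L (K L2)); split.
- apply: (cong_trans hcong) (cong_parr hcong L hK).
  apply: cong_Tr_Inf.
  + by rewrite parA.
  + by rewrite sameT.
  (* Every infinite trace of [L] is a letterwise renaming of [xi], so [K L1] does not restrict
     it. *)
  + rewrite Inf_par ?KA // setIidl // => zeta hz.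
    rewrite Inf_relabel; exists xi => [n|].
      by apply/renP => //; exact: Inf_alphabet.
    by rewrite Inf_par //; split=> //; rewrite Inf_path.
- exact: parA.
- exact: sameT.
(* An infinite trace of [K L2] would come from one shared by [L2] and [P]; [P] offers only [xi],
   which [L2] lacks. *)
- rewrite Inf_par ?KA // eqEsubset; split=> // zeta [_].
  rewrite Inf_relabel => -[xi' _]; rewrite Inf_par // => -[h].
  by rewrite Inf_path // => e; apply: xi2; rewrite -e.
Qed.

End Congruence.

Theorem theorem4p7 (Act : Type) (cong : LTS Act -> LTS Act -> Prop)
    (hcong : congruence cong)
    (hCFFD : forall L L' : LTS Act, CFFD L L' -> cong L L')
    (hTr : preserves cong (@Tr Act))
    (hInf : ~ preserves cong (@Inf Act))
    (hDV : cong (D Act) (V Act)) :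
  forall L L' : LTS Act,
    cong L L' <-> (alphabet L = alphabet L' /\ Tr L = Tr L').
Proof.
move=> L L'; split=> [h|[hA hT]].
  by split; [exact: (preserves_alphabet hcong hTr)|exact: hTr].
have [M [LM MA MT MI]] := cong_without_Inf hcong hCFFD hDV hTr L hInf.
have [M' [LM' MA' MT' MI']] := cong_without_Inf hcong hCFFD hDV hTr L' hInf.
apply: (cong_trans hcong) LM _; apply: (cong_trans hcong) (cong_sym hcong LM').
apply: (cong_Tr_Inf hcong hCFFD hDV).
- by rewrite MA hA.
- by rewrite MT hT.
- by rewrite MI MI'.
Qed.
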